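(* Let $\mathcal K\subset[0,1]$ be the classical middle-third Cantor set, let $T_3:\mathcal K\to\mathcal K$, $T_3(x)=3x\bmod 1$, let $\mu$ be the Cantor measure on $\mathcal K$, and let $\delta=\log_3 2$. Let $\psi:\mathbb{N}\to(0,\infty)$ be a positive function and $$R(T_3,\psi)=\{x\in\mathcal K:\ |T_3^nx-x|<\psi(n)\ \text{for infinitely many } n\in\mathbb{N}\}.$$ Then $$\mu(R(T_3,\psi))=\begin{cases}0 & \text{if } \sum_{n=1}^\infty\psi(n)^\delta<\infty,\\ 1 & \text{if } \sum_{n=1}^\infty\psi(n)^\delta=\infty.\end{cases}$$
   Context: The Cantor measure is the Borel probability measure on $\mathcal K$ which gives mass $2^{-n}$ to the part of $\mathcal K$ in each of the $2^n$ basic intervals of length $3^{-n}$ in the standard construction of $\mathcal K$, for every $n\ge0$. $3x\bmod1$ is the fractional part of $3x$. *)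

(* Defs.v *)
From mathcomp Require Import all_boot all_order all_algebra.
From mathcomp Require Import all_classical all_reals all_analysis.
Import Order.TTheory GRing.Theory Num.Theory.
Import numFieldNormedType.Exports.

Set Implicit Arguments.
Unset Strict Implicit.
Unset Printing Implicit Defensive.

Local Open Scope classical_set_scope.
Local Open Scope ring_scope.

(* [basic_interval n a b]: [a, b] is one of the 2 ^ n intervals of length
   3 ^ - n left after n removals of open middle thirds, starting from [0, 1]. *)
Inductive basic_interval (R : realType) : nat -> R -> R -> Prop :=
| basic_unit : basic_interval 0 0 1
| basic_left n a b :
    basic_interval n a b -> basic_interval n.+1 a (a + (b - a) / 3)
| basic_right n a b :
    basic_interval n a b -> basic_interval n.+1 (b - (b - a) / 3) b.

Definition cantor_set (R : realType) : set R :=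
  [set x | forall n, exists a b, basic_interval n a b /\ x \in `[a, b]].
Arguments cantor_set : clear implicits.

(* A Borel probability measure on the Cantor set is represented by a Borel
   probability measure on R; the case n = 0 forces it to be carried by the
   Cantor set. *)
Definition is_cantor_measure (R : realType)
    (mu : probability (measurableTypeR R) R) : Prop :=
  forall (n : nat) (a b : R), basic_interval n a b ->
    mu (cantor_set R `&` `[a, b]) = (2 ^- n)%:E.

Definition T3 (R : realType) (x : R) : R := 3 * x - (Num.floor (3 * x))%:~R.

(* The positive integers index the returns; the value psi 0 plays no role. *)
Definition recurrence_set (R : realType) (psi : nat -> R) : set R :=
  [set x | cantor_set R x /\
    infinite_set [set n : nat | (0 < n)%N /\ `|iter n (@T3 R) x - x| < psi n]].

(* Main.v *)
Require Import Defs.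
From mathcomp Require Import all_boot all_order all_algebra.
From mathcomp Require Import all_classical all_reals all_analysis.
From mathcomp Require Import measurable_realfun.
From mathcomp Require Import zify ring lra.
Import Order.TTheory GRing.Theory Num.Theory.
Import numFieldNormedType.Exports.
Local Open Scope classical_set_scope.
Local Open Scope ring_scope.

(** In the coding of the Cantor set by binary words (the digit [d] stands for
    the ternary digit [2 d]), [T3] is the shift and [mu] makes the digits
    independent fair coins. Two points of the Cantor set at distance less than
    [3 ^- m] lie in the same basic interval of level [m], and two points of the
    same basic interval are at distance at most [3 ^- m]. So, up to a factor
    [3] in the radius, the point [x] returns to within [3 ^- m] of itself at
    time [n] exactly when its digits satisfy the [m] equations
    [x_(n+i) = x_i], [i < m] ([repeats_at_dist], [dist_iter_T3_le]). These have
    probability [2 ^- m], and [2 ^- m] is the [delta]-th power of [3 ^- m];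
    hence the return at scale [psi n] has probability comparable to
    [min(1, psi n ^ delta)].

    If the series converges, the Borel-Cantelli lemma concludes.

    If it diverges, choose [m n] with [3 ^- (m n) < psi n] and [2 ^- (m n)]
    comparable to [min(1, psi n ^ delta)], and keep only the times with
    [m n <= n]: the others contribute at most the sum of the [2 ^- n]. The
    events [x_(n+i) = x_i], [i < m n], are then pairwise independent, exactly
    and in spite of the overlaps between the digits involved
    ([card_repeats2]). Indeed the equations for two times [n < n'] are the
    edges of a graph on the positions, and this graph is a forest as soon as
    [m n <= n]: added in a suitable order, each edge reaches a position that
    no earlier edge touches, so each equation halves the number of solutions.
    Pairwise independence and Chebyshev's inequality bound the probability that
    none of the events of a finite set of times occurs by the inverse of the
    sum of their probabilities ([card_avoid_le]); this tends to [0], so almost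
    every point returns after any given time. Since the independence
    is exact, this gives full measure and not only positive measure.

    Everything is counted on finite words. The dictionary between words and
    points only fails at right end points of basic intervals, where [T3]
    restarts from [0]; these are null ([mu_right_end]), and [mu_le_card]
    transfers an upper bound on a number of words into one on a measure. *)

(** * Counting words with repetitions *)

Lemma sum_pred_card (R : pzSemiRingType) (W : finType) (Q : pred W) :
  \sum_w (Q w)%:R = #|Q|%:R :> R.
Proof.
rewrite -sum1_card natr_sum [RHS]big_mkcond; apply: eq_bigr => w _.
by rewrite unfold_in; case: (Q w).
Qed.

Definition flip (N v : nat) (w : N.-tuple bool) : N.-tuple bool :=
  [tuple nth false w i (+) (i == v :> nat) | i < N].

Lemma nth_flip (N v i : nat) (w : N.-tuple bool) :
  (v < N)%N -> nth false (flip N v w) i = nth false w i (+) (i == v).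
Proof.
move=> vN; have [iN|Ni] := ltnP i N.
  have := tnth_mktuple (fun j : 'I_N => nth false w j (+) (j == v :> nat))
    (Ordinal iN).
  by rewrite (tnth_nth false).
rewrite !nth_default ?size_tuple//.
by case: eqP => // iv; rewrite iv leqNgt vN in Ni.
Qed.

Lemma flipK (N v : nat) : (v < N)%N -> involutive (flip N v).
Proof.
move=> vN w; apply/val_inj/(@eq_from_nth _ false); first by rewrite !size_tuple.
by move=> i _; rewrite !nth_flip// addbK.
Qed.

(** Flipping the digit [v] exchanges the words that satisfy the equation
    between the positions [a] and [v] with those that violate it. *)
Lemma card_halve (N : nat) (P : pred (N.-tuple bool)) (a v : nat) :
  (v < N)%N -> a != v -> (forall w, P (flip N v w) = P w) ->
  (#|[pred w : N.-tuple bool | P w & nth false w a == nth false w v]| * 2)%N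
    = #|P|.
Proof.
move=> vN av PK.
rewrite -(cardID [pred w : N.-tuple bool | nth false w a == nth false w v] P).
rewrite muln2 -addnn; congr (_ + _)%N.
rewrite -!sum1_card (reindex_inj (inv_inj (flipK N v vN))).
apply: eq_bigl => w; rewrite !inE PK !nth_flip// eqxx (negbTE av) addbF addbT.
by rewrite andbC; case: (nth _ _ a); case: (nth _ _ v).
Qed.

Definition repeats_at (n k : nat) (w : seq bool) : bool :=
  all (fun i => nth false w i == nth false w (n + i)%N) (iota 0 k).

Lemma repeats_atS (n k : nat) (w : seq bool) :
  repeats_at n k.+1 w =
  repeats_at n k w && (nth false w k == nth false w (n + k)%N).
Proof. by rewrite /repeats_at -addn1 iotaD all_cat/= andbT. Qed.

Lemma repeats_at_flip (N n k v : nat) (w : N.-tuple bool) : (v < N)%N ->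
  (forall i, (i < k)%N -> (i != v) && ((n + i)%N != v)) ->
  repeats_at n k (flip N v w) = repeats_at n k w.
Proof.
move=> vN nv; apply: eq_in_all => i; rewrite mem_iota => /nv /andP[iv niv].
by rewrite !nth_flip// (negbTE iv) (negbTE niv) !addbF.
Qed.

(** The total number of equations decreases by one at each step of the
    induction, and the equation removed has an end that no remaining equation
    involves. If [k' < k], remove the last equation [(k-1, n+k-1)] of the first
    family: the position [k-1] is beyond the left ends of the other equations,
    and before all right ends because [k <= n]. If [k <= k'], remove the last
    equation of the second family, whose right end [n'+k'-1] is the largest
    position in use since [n < n']. *)
Lemma card_repeats2 (N n k n' k' : nat) :
  (n < n')%N -> (k <= n)%N -> (n + k <= N)%N -> (n' + k' <= N)%N ->
  (#|[pred w : N.-tuple bool | repeats_at n k w & repeats_at n' k' w]|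
     * 2 ^ (k + k') = 2 ^ N)%N.
Proof.
move=> nn'; have [s] := ubnP (k + k')%N.
elim: s k k' => // s IH k k' ks kn knN kN'.
have [k'k|kk'] := ltnP k' k.
  case: k ks kn knN k'k => // k ks kn knN k'k.
  have {}IH := IH k k' ltac:(lia) ltac:(lia) ltac:(lia) kN'.
  rewrite addSn expnS mulnA -[RHS]IH; congr (_ * _)%N.
  rewrite -[RHS](@card_halve N _ (n + k) k); try lia.
    congr (_ * 2)%N; apply: eq_card => w; rewrite !inE repeats_atS eq_sym.
    by rewrite -!andbA; congr (_ && _); rewrite andbC.
  by move=> w; rewrite !inE !repeats_at_flip//; try lia;
    move=> i ik; apply/andP; split; apply/eqP; lia.
case: k' ks kN' kk' => [|k'] ks kN' kk'.
  have -> : k = 0%N by lia.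
  rewrite muln1 -[RHS](_ : #|{: N.-tuple bool}| = _); last first.
    by rewrite card_tuple card_bool.
  by apply: eq_card.
have {}IH := IH k k' ltac:(lia) kn knN ltac:(lia).
rewrite addnS expnS mulnA -[RHS]IH; congr (_ * _)%N.
rewrite -[RHS](@card_halve N _ k' (n' + k')); try lia.
  congr (_ * 2)%N; apply: eq_card => w; rewrite !inE repeats_atS.
  by rewrite andbA.
by move=> w; rewrite !inE !repeats_at_flip//; try lia;
  move=> i ik; apply/andP; split; apply/eqP; lia.
Qed.

(** The case [n = k = 0] of the previous lemma: the first family is then
    empty. *)
Lemma card_repeats (N n k : nat) : (0 < n)%N -> (n + k <= N)%N ->
  (#|[pred w : N.-tuple bool | repeats_at n k w]| * 2 ^ k = 2 ^ N)%N.
Proof. by move=> n0 nkN; have := @card_repeats2 N 0 0 n k n0 isT isT nkN. Qed.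

(** * Chebyshev's inequality for pairwise independent events *)

Section Chebyshev.
Context (R : realFieldType) (W : finType) (F : nat -> pred W) (p : nat -> R).

(** Divided by [#|W|], the left-hand side is the variance of the number of
    events that occur: the covariances vanish, and the variance [p - p ^+ 2]
    of an indicator is at most [p]. *)
Lemma variance_sum (s : seq nat) : uniq s ->
  (forall n, n \in s -> #|F n|%:R = #|W|%:R * p n) ->
  (forall n k, n \in s -> k \in s -> n != k ->
     #|[pred w | F n w & F k w]|%:R = #|W|%:R * (p n * p k)) ->
  \sum_w (\sum_(n <- s) ((F n w)%:R - p n)) ^+ 2 <= #|W|%:R * \sum_(n <- s) p n.
Proof.
have sump (c : R) : \sum_(w : W) c = #|W|%:R * c.
  by rewrite mulr_natl -sumr_const; apply: eq_bigl => w; rewrite inE.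
elim: s => [|n s IH] /=.
  by rewrite !big_nil mulr0 big1// => w _; rewrite big_nil expr0n.
move=> /andP[ns us] Fp Fpp; rewrite big_cons mulrDr.
under eq_bigr do rewrite big_cons sqrrD mulr2n.
rewrite !big_split /=.
(* by independence, the new event is uncorrelated with the sum of the others *)
have cross : \sum_w ((F n w)%:R - p n) * \sum_(k <- s) ((F k w)%:R - p k) = 0.
  under eq_bigr do rewrite mulr_sumr.
  rewrite exchange_big /= big_seq big1// => k ks.
  have nk : n != k by apply: contraNneq ns => ->.
  transitivity (\sum_w ((F n w && F k w)%:R - p k * (F n w)%:R
                         - p n * (F k w)%:R + p n * p k)).
    by apply: eq_bigr => w _; case: (F n w); case: (F k w) => /=; ring.
  rewrite !big_split /= !sumrN -!mulr_sumr !sum_pred_card sump.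
  rewrite (Fpp n k) ?Fp ?inE ?eqxx ?ks ?orbT//.
  ring.
rewrite cross !addr0 lerD//; last first.
  by apply: IH => //; [move=> k ks|move=> k l ks ls];
     [apply: Fp|apply: Fpp]; rewrite inE ?ks ?ls orbT.
rewrite -sump -subr_ge0 -sumrB.
have -> : \sum_w (p n - ((F n w)%:R - p n) ^+ 2) =
   \sum_w (p n - (1 - 2 * p n) * (F n w)%:R - p n ^+ 2).
  by apply: eq_bigr => w _; case: (F n w) => /=; ring.
rewrite !big_split /= !sumrN -!mulr_sumr sum_pred_card !sump Fp ?inE ?eqxx//.
rewrite (_ : _ - _ - _ = #|W|%:R * (p n) ^+ 2); last by ring.
by rewrite mulr_ge0// sqr_ge0.
Qed.

(** Chebyshev's inequality: where no event occurs, their number is at distance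
    [\sum_(n <- s) p n] from its mean. *)
Lemma card_avoid_le (s : seq nat) : uniq s -> (forall n, 0 <= p n) ->
  (forall n, n \in s -> #|F n|%:R = #|W|%:R * p n) ->
  (forall n k, n \in s -> k \in s -> (n < k)%N ->
     #|[pred w | F n w & F k w]|%:R = #|W|%:R * (p n * p k)) ->
  #|[pred w | ~~ has (fun n => F n w) s]|%:R * \sum_(n <- s) p n <= #|W|%:R.
Proof.
move=> us p0 Fp Fpp.
have Fpp' n k : n \in s -> k \in s -> n != k ->
     #|[pred w | F n w & F k w]|%:R = #|W|%:R * (p n * p k).
  move=> ns ks; rewrite neq_ltn => /orP[nk|kn]; first exact: Fpp.
  rewrite [p n * _]mulrC -Fpp//; congr (_%:R); apply: eq_card => w.
  by rewrite !inE andbC.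
have := variance_sum s us Fp Fpp'; set E := \sum_(n <- s) p n => vE.
have E0 : 0 <= E by exact: sumr_ge0.
move: E0; rewrite le_eqVlt => /predU1P[<-|E0]; first by rewrite mulr0.
rewrite -(ler_pM2r E0) -mulrA -expr2; apply: le_trans vE.
rewrite [leRHS](bigID [pred w | ~~ has (fun n => F n w) s]) /=.
rewrite -[leLHS]addr0 lerD//; last by apply: sumr_ge0 => w _; exact: sqr_ge0.
rewrite mulr_natl -sumr_const ler_sum// => w; rewrite inE => /hasPn nF.
rewrite -[X in _ <= X ^+ 2]opprK sqrrN -sumrN /E le_eqVlt; apply/orP; left.
apply/eqP; congr (_ ^+ 2); apply: eq_big_seq => n /nF /negbTE ->.
by rewrite sub0r opprK.
Qed.
End Chebyshev.

(** * Basic intervals, words and the shift *)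

Section Words.
Context {R : realType}.
Implicit Types (s u v w : seq bool) (x y : R).

(** [left_end s] and [right_end s] bound the basic interval selected by [s],
    where [true] takes the right third and [false] the left one, the first
    digit being the first choice. *)
Fixpoint left_end s : R :=
  if s is d :: s' then (2 * d%:R + left_end s') / 3 else 0.

Definition right_end s : R := left_end s + 3 ^- size s.

Definition cylinder s : set R := `[left_end s, right_end s].

Lemma cylinderE s x : cylinder s x <-> left_end s <= x <= right_end s.
Proof. by rewrite /cylinder /= in_itv. Qed.

Lemma exp3_gt0 n : 0 < 3 ^- n :> R.
Proof. by rewrite invr_gt0 exprn_gt0. Qed.

(** The bound [k < b ^ k] makes [k] of the order of [t^-1] large enough. *)
Lemma exists_expV_lt (b : nat) (t : R) : (1 < b)%N -> 0 < t ->
  exists m, b%:R ^- m < t.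
Proof.
move=> b1 t0; have b0 : 0 < b%:R :> R by rewrite ltr0n; lia.
exists (Num.truncn t^-1).+1.
rewrite invf_plt ?posrE ?exprn_gt0//.
apply: lt_trans (truncnS_gt _) _.
by rewrite -natrX ltr_nat ltn_expl.
Qed.

Lemma left_end_cat u v :
  left_end (u ++ v) = left_end u + 3 ^- size u * left_end v.
Proof.
elim: u => [|d u IH] /=; first by rewrite expr0 invr1 mul1r add0r.
by rewrite IH exprS invfM; field; rewrite expf_neq0.
Qed.

Lemma left_end_ge0 s : 0 <= left_end s.
Proof. by elim: s => //= d s IH; rewrite divr_ge0// addr_ge0// mulr_ge0. Qed.

Lemma right_end_cons d s : right_end (d :: s) = (2 * d%:R + right_end s) / 3.
Proof.
by rewrite /right_end /= exprS invfM; field; rewrite expf_neq0.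
Qed.

Lemma right_end_le1 s : right_end s <= 1.
Proof.
elim: s => [|d s IH]; first by rewrite /right_end /= expr0 invr1 add0r.
by rewrite right_end_cons; case: d => /=; lra.
Qed.

Lemma left_end_lt_right s : left_end s < right_end s.
Proof. by rewrite ltrDl exp3_gt0. Qed.

Lemma right_end_cat u v :
  right_end (u ++ v) = left_end u + 3 ^- size u * right_end v.
Proof.
by rewrite /right_end left_end_cat size_cat exprD invfM mulrDr addrA.
Qed.

Lemma right_end_cat_le u v : right_end (u ++ v) <= right_end u.
Proof.
rewrite right_end_cat /right_end lerD2l.
by rewrite -[leRHS]mulr1 ler_pM2l ?exp3_gt0// right_end_le1.
Qed.

Lemma cylinder_prefix u v x : cylinder (u ++ v) x -> cylinder u x.
Proof.
move=> /cylinderE /andP[lx xr]; apply/cylinderE/andP; split.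
  apply: le_trans lx; rewrite left_end_cat lerDl.
  by rewrite mulr_ge0 ?left_end_ge0// ltW// exp3_gt0.
exact: le_trans xr (right_end_cat_le u v).
Qed.

(** The affine map from the basic interval of [u] onto the unit interval drops
    the prefix [u]. *)
Lemma cylinder_suffix u v x : cylinder (u ++ v) x ->
  cylinder v (3 ^+ size u * (x - left_end u)).
Proof.
move=> /cylinderE; rewrite left_end_cat right_end_cat => /andP[lx xr].
have e0 : 0 < 3 ^+ size u :> R by rewrite exprn_gt0.
apply/cylinderE/andP; split.
  by rewrite -ler_pdivrMl//; lra.
by rewrite -ler_pdivlMl//; lra.
Qed.

Lemma dist_cylinder s x y :
  cylinder s x -> cylinder s y -> `|x - y| <= 3 ^- size s.
Proof.
rewrite !cylinderE /right_end => /andP[lx xr] /andP[ly yr].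
by rewrite ler_norml; apply/andP; split; lra.
Qed.

(** Distinct basic intervals of the same level are separated by a removed
    middle third, which has at least their length. *)
Lemma cylinder_sep u v x y : size u = size v -> cylinder u x -> cylinder v y ->
  `|x - y| < 3 ^- size u -> u = v.
Proof.
rewrite !cylinderE.
elim: u v x y => [|d u IH] [|e v] x y //= [] uv.
rewrite !right_end_cons => /andP[lx xr] /andP[ly yr].
rewrite exprS invfM => xy.
have : 3 ^- size u <= 1 :> R.
  by rewrite invf_le1 ?exprn_gt0// exprn_ege1// ler1n.
move: (left_end_ge0 u) (left_end_ge0 v) (right_end_le1 u) (right_end_le1 v).
move: xy (IH v (3 * x - 2 * d%:R) (3 * y - 2 * d%:R) uv).
rewrite !ltr_norml; move: (3 ^- size u : R) => q {uv IH} /andP[xy yx] IH.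
move=> lu lv ru rv q1.
have de : d = e.
  move: lx xr ly yr; clear IH; case: d e => [] [] /= *; try done; exfalso; lra.
rewrite -{}de in ly yr |- *; congr (_ :: _).
apply: IH.
- by apply/andP; split; lra.
- by apply/andP; split; lra.
- by apply/andP; split; lra.
Qed.

Lemma left_end_rcons s d : left_end (rcons s d) =
  if d then right_end s - (right_end s - left_end s) / 3 else left_end s.
Proof.
rewrite -cats1 left_end_cat /right_end /=.
by case: d => /=; field; rewrite expf_neq0.
Qed.

Lemma right_end_rcons s d : right_end (rcons s d) =
  if d then right_end s else left_end s + (right_end s - left_end s) / 3.
Proof.
rewrite -cats1 right_end_cat right_end_cons /right_end /= expr0 invr1.
by case: d => /=; field; rewrite expf_neq0.
Qed.

Lemma basic_interval_word n (a b : R) : basic_interval n a b ->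
  exists w : n.-tuple bool, a = left_end w /\ b = right_end w.
Proof.
elim=> [|{}n {}a {}b _ [w [-> ->]]|{}n {}a {}b _ [w [-> ->]]].
- by exists [tuple]; rewrite /right_end /= expr0 invr1 add0r.
- exists [tuple of rcons w false].
  by rewrite left_end_rcons right_end_rcons.
- exists [tuple of rcons w true].
  by rewrite left_end_rcons right_end_rcons.
Qed.

Lemma word_basic_interval s :
  basic_interval (size s) (left_end s) (right_end s).
Proof.
elim/last_ind: s => [|s d IH].
  by rewrite /right_end /= expr0 invr1 add0r; exact: basic_unit.
rewrite size_rcons left_end_rcons right_end_rcons.
by case: d; [exact: basic_right|exact: basic_left].
Qed.

Lemma cantor_setE : cantor_set R =
  \bigcap_n \bigcup_(w in [set: n.-tuple bool]) cylinder w.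
Proof.
apply/seteqP; split => x /= Kx n.
  move=> _; have [a [b [/basic_interval_word[w [-> ->]] xab]]] := Kx n.
  by exists w.
have [w _ xw] := Kx n I; exists (left_end w), (right_end w); split => //.
by have := word_basic_interval w; rewrite size_tuple.
Qed.

Lemma measurable_cantor_set :
  measurable (cantor_set R : set (measurableTypeR R)).
Proof.
rewrite cantor_setE; apply: bigcap_measurable => // n _.
apply: fin_bigcup_measurable => [|w _]; first exact: finite_finset.
exact: measurable_itv.
Qed.

(** For nonempty [u] the right end point must be excluded: the fractional part
    sends it to [0] where the affine branch gives [1]. *)
Lemma iter_T3 u x : left_end u <= x < right_end u ->
  iter (size u) (@T3 R) x = 3 ^+ size u * (x - left_end u).
Proof.
elim: u x => [|d u IH] x /=; first by rewrite expr0 mul1r subr0.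
rewrite right_end_cons -iterS iterSr => /andP[lx xr].
have -> : T3 x = 3 * x - 2 * d%:R.
  have dE : (2 * d)%N%:Z%:~R = 2 * d%:R :> R by rewrite -pmulrn natrM.
  rewrite /T3 -dE; congr (_ - _%:~R); apply: floor_def.
  have := left_end_ge0 u; have := right_end_le1 u; rewrite intrD dE.
  by move=> *; apply/andP; split; lra.
rewrite IH; last by apply/andP; split; lra.
by rewrite exprSr; field.
Qed.

Lemma repeats_atE n m w : (n + m <= size w)%N ->
  repeats_at n m w = (take m w == take m (drop n w)).
Proof.
move=> nmw.
have sw : size (take m w) = m by rewrite size_takel; lia.
have sd : size (take m (drop n w)) = m by rewrite size_takel// size_drop; lia.
apply/allP/eqP => [wi|wi i].
  apply: (@eq_from_nth _ false); rewrite sw ?sd// => i im.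
  by rewrite !nth_take// nth_drop; apply/eqP/wi; rewrite mem_iota.
rewrite mem_iota => /= im; have := congr1 (fun s => nth false s i) wi.
by rewrite !nth_take// nth_drop => ->.
Qed.

Lemma cylinder_take w m x : cylinder w x -> cylinder (take m w) x.
Proof. by rewrite -{1}(cat_take_drop m w); exact: cylinder_prefix. Qed.

Lemma cylinder_iter_T3 n m w x : (n + m <= size w)%N -> cylinder w x ->
  x != right_end w -> cylinder (take m (drop n w)) (iter n (@T3 R) x).
Proof.
move=> nmw wx xr.
have sn : size (take n w) = n by rewrite size_takel; lia.
apply: cylinder_take; rewrite -{2}sn iter_T3.
  by apply: cylinder_suffix; rewrite cat_take_drop.
move: (cylinder_take w n x wx) => /cylinderE /andP[-> _] /=.
apply: lt_le_trans (right_end_cat_le _ (drop n w)); rewrite cat_take_drop.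
by rewrite lt_neqAle xr; move: wx => /cylinderE/andP[].
Qed.

Lemma dist_iter_T3_le n m w x : (n + m <= size w)%N -> cylinder w x ->
  x != right_end w -> repeats_at n m w ->
  `|iter n (@T3 R) x - x| <= 3 ^- m.
Proof.
move=> nmw wx xr; rewrite repeats_atE// => /eqP e.
have -> : m = size (take m w) by rewrite size_takel; lia.
apply: dist_cylinder; last exact: cylinder_take.
by rewrite {1}e; exact: cylinder_iter_T3.
Qed.

Lemma repeats_at_dist n m w x : (n + m <= size w)%N -> cylinder w x ->
  x != right_end w -> `|iter n (@T3 R) x - x| < 3 ^- m ->
  repeats_at n m w.
Proof.
move=> nmw wx xr; rewrite repeats_atE// => h; apply/eqP/esym.
have sm : size (take m (drop n w)) = m.
  by rewrite size_takel// size_drop; lia.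
apply: (@cylinder_sep _ _ (iter n (@T3 R) x) x).
- by rewrite sm size_takel; lia.
- exact: cylinder_iter_T3.
- exact: cylinder_take.
- by rewrite sm.
Qed.

End Words.

(** * Measurability of the recurrence set *)

Section Measurability.
Context {R : realType}.

Lemma measurable_T3 :
  measurable_fun setT (@T3 R : measurableTypeR R -> measurableTypeR R).
Proof.
rewrite /T3; apply: measurable_funB.
  by apply: measurable_funM => //; exact: measurable_cst.
apply: nondecreasing_measurable => // x y xy.
by rewrite ler_int; apply: le_floor; rewrite ler_pM2l.
Qed.

Lemma measurable_iter_T3 n :
  measurable_fun setT (iter n (@T3 R) : measurableTypeR R -> measurableTypeR R).
Proof.
elim: n => [|n IH]; first exact: measurable_id.
exact: (measurableT_comp measurable_T3 IH).
Qed.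

Definition returns (n : nat) (r : R) : set R :=
  [set x | cantor_set R x /\ `|iter n (@T3 R) x - x| < r].

Lemma measurable_returns n r :
  measurable (returns n r : set (measurableTypeR R)).
Proof.
have -> : returns n r = cantor_set R `&`
   (fun x => `|iter n (@T3 R) x - x| < r) @^-1` [set true].
  by apply/seteqP; split => x.
apply: measurableI; first exact: measurable_cantor_set.
rewrite -[X in measurable X]setTI.
have mf : measurable_fun setT
    (fun x : measurableTypeR R => `|iter n (@T3 R) x - x|).
  apply: measurableT_comp; first exact: normr_measurable.
  apply: measurable_funB; first exact: measurable_iter_T3.
  exact: measurable_id.
have := measurable_fun_ltr mf (measurable_cst (r : measurableTypeR R)).
by apply.
Qed.

Lemma infinite_nat_setP (S : set nat) :
  infinite_set S <-> forall A, exists2 n, (A <= n)%N & S n.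
Proof.
split=> [infS A|SA finS].
  apply: contrapT => nS; apply: infS; apply: sub_finite_set (finite_II A).
  by move=> n Sn /=; rewrite ltnNge; apply/negP => An; apply: nS; exists n.
have [n + Sn] := SA (\max_(i <- finmap.enum_fset (fset_set S)) i).+1.
by rewrite ltnNge leq_bigmax_seq// in_fset_set// inE.
Qed.

Lemma recurrence_setE (psi : nat -> R) :
  recurrence_set psi = lim_sup_set (fun n => returns n.+1 (psi n.+1)).
Proof.
apply/seteqP; split=> x.
  move=> [Kx /infinite_nat_setP xA] A _.
  have [[//|n] An [_ xn]] := xA A.+1.
  by exists n.
move=> xA; split; first by have [n _ []] := xA 0%N I.
apply/infinite_nat_setP => A; have [n An [_ xn]] := xA A I.
by exists n.+1 => //; exact: leqW.
Qed.
End Measurability.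

(** * The Cantor measure of sets described by words *)

Section CantorMeasure.
Context {R : realType} (mu : probability (measurableTypeR R) R).
Context (hmu : is_cantor_measure mu).

Lemma mu_cylinder s : mu (cantor_set R `&` cylinder s) = (2 ^- size s)%:E.
Proof. exact: hmu (word_basic_interval s). Qed.

Lemma measurable_cylinderI s :
  measurable (cantor_set R `&` cylinder s : set (measurableTypeR R)).
Proof.
by apply: measurableI; [exact: measurable_cantor_set|exact: measurable_itv].
Qed.

Lemma measurable_endI s :
  measurable (cantor_set R `&` [set right_end s] : set (measurableTypeR R)).
Proof.
by apply: measurableI; [exact: measurable_cantor_set|exact: measurable_set1].
Qed.

(** The basic intervals obtained from [s] by always choosing the right third
    all contain the right end point of [s], and their masses tend to [0]. *)
Lemma mu_right_end s : mu (cantor_set R `&` [set right_end s]) = 0%E.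
Proof.
have le k : (mu (cantor_set R `&` [set right_end s]) <= (2 ^- k)%:E)%E.
  pose t := s ++ nseq k true.
  have rt : right_end t = right_end s :> R.
    rewrite right_end_cat (_ : right_end _ = 1 :> R) ?mulr1//.
    elim: k {t} => [|k IH]; first by rewrite /right_end /= expr0 invr1 add0r.
    by rewrite /= right_end_cons IH /=; lra.
  apply: (@le_trans _ _ (mu (cantor_set R `&` cylinder t))).
    apply: le_measure; rewrite ?inE.
    - exact: measurable_endI.
    - exact: measurable_cylinderI.
    - move=> x [Kx xr]; split=> //; apply/cylinderE; rewrite xr -rt lexx andbT.
      exact/ltW/left_end_lt_right.
  rewrite mu_cylinder lee_fin lef_pV2 ?posrE ?exprn_gt0//.
  by rewrite ler_eXn2l ?ltr1n// size_cat size_nseq leq_addl.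
apply/eqP; rewrite eq_le measure_ge0 andbT leNgt; apply/negP => mu0.
have mufin : mu (cantor_set R `&` [set right_end s]) \is a fin_num.
  exact: fin_num_measure (measurable_endI s).
rewrite -(fineK mufin) lte_fin in mu0.
have [k] := exists_expV_lt 2 _ isT mu0.
by rewrite ltNge -lee_fin fineK// le.
Qed.

(** Cover [A] by the basic intervals of the words in [P] and the right end
    points of the others; the latter are null. *)
Lemma mu_le_card N (P : pred (N.-tuple bool)) (A : set R) :
  measurable (A : set (measurableTypeR R)) -> A `<=` cantor_set R ->
  (forall (w : N.-tuple bool) x, A x -> cylinder w x -> x != right_end w ->
     P w) ->
  (mu A <= (#|P|%:R * 2 ^- N)%:E)%E.
Proof.
move=> mA AK AP.
pose C (w : N.-tuple bool) : set R :=
  if P w then cantor_set R `&` cylinder w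
  else cantor_set R `&` [set right_end w].
have muC w : mu (C w) = ((P w)%:R * 2 ^- N)%:E.
  rewrite /C; case: (P w); last by rewrite mu_right_end mul0r.
  by rewrite mu_cylinder size_tuple mul1r.
have sumC : (\sum_(w \in [set` enum {: N.-tuple bool}]) mu (C w))%R
    = (#|P|%:R * 2 ^- N)%:E.
  rewrite -fsbig_seq ?enum_uniq// big_enum/=.
  under eq_bigr do rewrite muC.
  by rewrite sumEFin -mulr_suml sum_pred_card.
rewrite -sumC; apply: content_sub_fsum => //.
  move=> w _; rewrite /C; case: (P w); last exact: measurable_endI.
  exact: measurable_cylinderI.
move=> x Ax; have /= := AK x Ax.
rewrite cantor_setE => /(_ N I)[w _ wx]; exists w; first by rewrite /= mem_enum.
have Kx := AK x Ax.
rewrite /C; case: ifPn => [//|nPw]; split => //=; apply/eqP.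
by apply: contraNT nPw => xr; exact: AP Ax wx xr.
Qed.

(** A return closer than [3 ^- m] forces [m] repeated digits. *)
Lemma mu_returns_le n r m : (0 < n)%N -> r <= 3 ^- m ->
  (mu (returns n r) <= (2 ^- m)%:E)%E.
Proof.
move=> n0 rm.
have := mu_le_card (n + m) (fun w => repeats_at n m w) (returns n r).
have := @card_repeats (n + m) n m n0 (leqnn _).
move=> /(congr1 (fun k : nat => k%:R : R)) card.
have -> : #|fun w : (n + m).-tuple bool => repeats_at n m w|%:R * 2 ^- (n + m)
    = 2 ^- m :> R.
  rewrite !natrX natrM natrX in card.
  apply: (@mulIf _ (2 ^+ (n + m))); first by rewrite expf_neq0.
  rewrite mulfVK ?expf_neq0// -card mulrCA mulVf ?expf_neq0// mulr1.
  by congr (_%:R); apply: eq_card.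
apply.
- exact: measurable_returns.
- by move=> x [].
- move=> w x [Kx xr] wx xw.
  apply: (@repeats_at_dist _ _ _ _ x) => //; first by rewrite size_tuple.
  exact: lt_le_trans xr rm.
Qed.

Lemma mu_cantor_set : mu (cantor_set R) = 1%E.
Proof.
have := mu_cylinder [::]; rewrite /= expr0 invr1 => K1.
apply/eqP; rewrite eq_le probability_le1/=; last exact: measurable_cantor_set.
rewrite -K1; apply: le_measure; rewrite ?inE.
- exact: measurable_cylinderI.
- exact: measurable_cantor_set.
- by move=> x [].
Qed.

End CantorMeasure.

(** * Ternary scales and series *)

Section Scales.
Context {R : realType}.
Notation delta := (ln 2 / ln 3 : R).

Lemma delta_ge0 : 0 <= delta.
Proof. by rewrite divr_ge0// ln_ge0// ler1n. Qed.

Lemma powR_exp3 m : (3 ^- m) `^ delta = 2 ^- m :> R.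
Proof.
have ln3 : ln 3 != 0 :> R by rewrite gt_eqF// ln_gt0// ltr1n.
rewrite /powR gt_eqF ?exp3_gt0// lnV ?posrE ?exprn_gt0// lnXn//.
rewrite (_ : _ * _ = m%:R * - ln 2); last by rewrite -mulr_natl; field.
by rewrite expRM_natl expRN lnK ?posrE// exprVn.
Qed.

Lemma powR_delta_le (s t : R) : 0 <= s -> s <= t -> s `^ delta <= t `^ delta.
Proof.
move=> s0 st; apply: ge0_ler_powR => //; rewrite ?nnegrE//.
  exact: delta_ge0.
exact: le_trans st.
Qed.

Lemma exists_scale (t : R) : 0 < t -> t <= 1 ->
  exists m, 3 ^- m.+1 < t <= 3 ^- m.
Proof.
move=> t0 t1; have [m mt mmin] := ex_minnP (exists_expV_lt 3 t isT t0).
case: m mt mmin => [|m] mt mmin.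
  by rewrite expr0 invr1 ltNge t1 in mt.
by exists m; rewrite mt leNgt; apply/negP => /mmin; rewrite ltnn.
Qed.

Lemma exists_scale_ge (t : R) : 0 < t -> t <= 1 ->
  exists m, t <= 3 ^- m /\ 2 ^- m <= 2 * t `^ delta.
Proof.
move=> t0 t1; have [m /andP[mt tm]] := exists_scale t t0 t1.
exists m; split => //; rewrite mulrC -ler_pdivrMr//.
rewrite -invfM -exprSr -powR_exp3 powR_delta_le//; last exact: ltW.
Qed.

(** For [1 < t] the scale [m = 0] is used, which is why [t `^ delta] has to be
    truncated. *)
Lemma exists_scale_lt (t : R) : 0 < t ->
  exists m, 3 ^- m < t /\ Num.min 1 (t `^ delta) <= 2 * 2 ^- m.
Proof.
move=> t0; have [t1|t1] := leP t 1; last first.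
  exists 0%N; rewrite expr0 invr1; split => //.
  by rewrite ge_min mulr1 ler1n.
have [m /andP[mt tm]] := exists_scale t t0 t1.
exists m.+1; split => //; rewrite exprS invfM mulrA divff// mul1r.
by rewrite ge_min -powR_exp3 (powR_delta_le t)// ?orbT// ltW.
Qed.

(** If the truncated series were bounded, its terms would tend to [0], so that
    from some index on the truncation at [1] would not change them and the
    original series would converge. *)
Lemma sum_minr1_unbounded (a : nat -> R) (A : nat) (M : R) :
  (forall n, 0 <= a n) -> (\sum_(1 <= n <oo) (a n)%:E = +oo)%E ->
  exists B, M <= \sum_(A <= n < B) Num.min 1 (a n).
Proof.
move=> a0 aoo; apply: contrapT => nB.
pose u n := if (A <= n)%N then Num.min 1 (a n) else 0.
have u0 n : 0 <= u n by rewrite /u; case: ifP => // _; rewrite le_min ler01 a0.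
have uM B : \sum_(0 <= n < B) u n <= M.
  have [|BM] := leP M (\sum_(A <= n < B) Num.min 1 (a n)).
    by move=> BM; exfalso; apply: nB; exists B.
  apply: le_trans (ltW BM).
  by rewrite [leRHS](big_nat_widenl _ 0%N)//= [leRHS]big_mkcond.
have ucvg : cvgn (series u).
  apply: nondecreasing_is_cvgn.
    by apply/nondecreasing_seqP => n; rewrite seriesSr lerDl.
  by exists M => _ [n _ <-]; exact: uM.
have /cvgr_lt/(_ 1 ltr01) := cvg_series_cvg_0 ucvg.
case=> n0 _ n0u.
pose n1 := maxn n0 A.
have au n : (n1 <= n)%N -> a n = u n.
  rewrite geq_max => /andP[n0n An]; have := n0u n n0n.
  rewrite /= /u An minElt; case: (ltP 1 (a n)) => //=.
  by rewrite ltxx.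
have : (\sum_(1 <= n <oo) (a n)%:E <= (\sum_(1 <= n < n1.+1) a n + M)%:E)%E.
  apply: lime_le.
    by apply: is_cvg_nneseries => n _ _; rewrite lee_fin.
  exists n1.+1 => // N /= n1N.
  rewrite sumEFin lee_fin (@big_cat_nat _ _ _ n1.+1)//= lerD2l.
  apply: le_trans (uM N); rewrite [leRHS](@big_cat_nat _ _ _ n1.+1)//=.
  rewrite -[leLHS]add0r lerD//; first exact: sumr_ge0.
  rewrite le_eqVlt; apply/orP; left; apply/eqP.
  by apply: eq_big_nat => n /andP[n1n _]; rewrite au// ltnW.
by rewrite aoo leye_eq.
Qed.

(** This controls the times [n] with [n < m n], which are discarded. *)
Lemma sum_expV2_le A B : \sum_(A <= n < B) 2 ^- n <= 2 :> R.
Proof.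
have [AB|BA] := leqP A B; last by rewrite big_geq// ltnW.
(* telescoping form of the geometric sum, suited to induction on [B] *)
suff : \sum_(A <= n < B) 2 ^- n <= 2 * 2 ^- A - 2 * 2 ^- B :> R.
  move=> /le_trans; apply; rewrite lerBlDr.
  apply: (@le_trans _ _ (2 : R)); last by rewrite lerDl mulr_ge0.
  by rewrite -[leRHS]mulr1 ler_pM2l// invf_le1 ?exprn_gt0// exprn_ege1// ler1n.
elim: B AB => [|B IH].
  by rewrite leqn0 => /eqP ->; rewrite big_geq// subrr.
rewrite leq_eqVlt => /predU1P[->|AB]; first by rewrite big_geq// subrr.
rewrite big_nat_recr//=.
apply: (le_trans (lerD (IH AB) (lexx _))).
rewrite exprS invfM mulrA divff// mul1r; lra.
Qed.

End Scales.

(** * The two cases of the dichotomy *)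

Section Dichotomy.
Context {R : realType} (mu : probability (measurableTypeR R) R).
Context (hmu : is_cantor_measure mu).
Notation delta := (ln 2 / ln 3 : R).

Lemma mu_returns_le_powR n r : (0 < n)%N -> 0 < r ->
  (mu (returns n r) <= (2 * r `^ delta)%:E)%E.
Proof.
move=> n0 r0; have [r1|r1] := leP r 1.
  have [m [rm mr]] := exists_scale_ge r r0 r1.
  by apply: le_trans (mu_returns_le mu hmu n r m n0 rm) _; rewrite lee_fin.
apply: (@le_trans _ _ 1%E).
  by apply: probability_le1; exact: measurable_returns.
have -> : 1%E = ((3 ^- 0) `^ delta)%:E :> \bar R.
  by rewrite expr0 invr1 powR1.
rewrite lee_fin -[leLHS]mul1r ler_pM ?powR_ge0 ?ler1n//.
by rewrite powR_delta_le// expr0 invr1 ltW.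
Qed.

Lemma mu_recurrence_set0 (psi : nat -> R) :
  (forall n, (0 < n)%N -> 0 < psi n) ->
  (\sum_(1 <= n <oo) (psi n `^ delta)%:E < +oo)%E ->
  mu (recurrence_set psi) = 0%E.
Proof.
move=> psi0 fin; rewrite recurrence_setE; apply: lim_sup_set_cvg0.
  by move=> n; exact: measurable_returns.
apply: le_lt_trans
  (_ : \sum_(0 <= n <oo) (2%:E * (psi n.+1 `^ delta)%:E) < _)%E.
  apply: lee_nneseries => // n _; rewrite -EFinM.
  by apply: mu_returns_le_powR => //; exact: psi0.
rewrite nneseriesZl; last by move=> n _; rewrite lee_fin powR_ge0.
under eq_eseriesr do rewrite -addn1.
rewrite (@nneseries_addn _ (fun n => (psi n `^ delta)%:E)); last first.
  by move=> n; rewrite lee_fin powR_ge0.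
by rewrite lte_mul_pinfty// lee_fin.
Qed.

(** Chebyshev's bound, read on words long enough to decide the [m n] repeated
    digits at every time [n] of [s]. *)
Lemma mu_avoid_le (psi : nat -> R) (m : nat -> nat) (s : seq nat) (A : set R) :
  uniq s ->
  (forall n, n \in s -> [/\ (0 < n)%N, (m n <= n)%N & 3 ^- m n < psi n]) ->
  measurable (A : set (measurableTypeR R)) -> A `<=` cantor_set R ->
  (forall n x, n \in s -> A x -> ~ returns n (psi n) x) ->
  (mu A * (\sum_(n <- s) 2 ^- m n)%:E <= 1)%E.
Proof.
move=> us sP mA AK AP.
pose N := \max_(n <- s) (n + m n).
have sN n : n \in s -> (n + m n <= N)%N by move=> ns; exact: leq_bigmax_seq.
pose F n (w : N.-tuple bool) := repeats_at n (m n) w.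
have cardN : #|{: N.-tuple bool}| = (2 ^ N)%N by rewrite card_tuple card_bool.
have e2 k : 2 ^+ k != 0 :> R by rewrite expf_neq0.
pose bad : pred (N.-tuple bool) := fun w => ~~ has (fun n => F n w) s.
set E := \sum_(n <- s) 2 ^- m n.
have bE : #|bad|%:R * E <= 2 ^+ N :> R.
  rewrite -[leRHS]natrX -cardN; apply: card_avoid_le => //.
  - move=> n ns; have [n0 _ _] := sP n ns.
    have /(congr1 (fun k : nat => k%:R : R)) :=
      card_repeats N n (m n) n0 (sN n ns).
    by rewrite cardN natrM !natrX => <-; rewrite mulfK.
  - move=> n k ns ks nk; have [n0 mn _] := sP n ns.
    have /(congr1 (fun k : nat => k%:R : R)) :=
      card_repeats2 N n (m n) k (m k) nk mn (sN n ns) (sN k ks).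
    by rewrite cardN natrM !natrX exprD => <-; field; rewrite !e2.
have muA : (mu A <= (#|bad|%:R * 2 ^- N)%:E)%E.
  apply: (mu_le_card mu hmu N bad A mA AK).
  move=> w x Ax wx xr; apply/hasPn => n ns; apply/negP => Fw.
  have [_ _ mpsi] := sP n ns.
  apply: (AP n x ns Ax); split; first exact: AK.
  apply: le_lt_trans mpsi; apply: (@dist_iter_T3_le _ _ _ w) => //.
  by rewrite size_tuple sN.
apply: le_trans (_ : (#|bad|%:R * 2 ^- N)%:E * E%:E <= _)%E.
  by rewrite lee_wpmul2r// lee_fin sumr_ge0// => n _;
    rewrite ltW// invr_gt0 exprn_gt0.
by rewrite -EFinM lee_fin mulrAC ler_pdivrMr ?exprn_gt0// mul1r.
Qed.

(** If the measure [g] were positive, the sum of the [2 ^- m n] over the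
    retained times in any range starting at [A] would be at most [g^-1]; with
    the discarded times, the truncated series would be bounded. *)
Lemma mu_avoid_tail0 (psi : nat -> R) (A : nat) :
  (0 < A)%N -> (forall n, (0 < n)%N -> 0 < psi n) ->
  (\sum_(1 <= n <oo) (psi n `^ delta)%:E = +oo)%E ->
  mu (cantor_set R `\` \bigcup_(n >= A) returns n (psi n)) = 0%E.
Proof.
move=> A0 psi0 poo.
set G := _ `\` _.
have mG : measurable (G : set (measurableTypeR R)).
  apply: measurableD; first exact: measurable_cantor_set.
  by apply: bigcup_measurable => n _; exact: measurable_returns.
have /choice[m mP] n : exists k, (0 < n)%N ->
    3 ^- k < psi n /\ Num.min 1 (psi n `^ delta) <= 2 * 2 ^- k.
  case: n => [|n]; first by exists 0%N.
  by have [k kP] := exists_scale_lt _ (psi0 n.+1 isT); exists k.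
apply/eqP; rewrite eq_le measure_ge0 andbT leNgt; apply/negP => mu0.
have mufin : mu G \is a fin_num by exact: fin_num_measure mG.
rewrite -(fineK mufin) lte_fin in mu0.
set g := fine (mu G) in mu0.
(* retained times give at most [2 g^-1], discarded ones at most [2 * 2] *)
have [B] := sum_minr1_unbounded _ A (2 * (g^-1 + 1) + 2 * 2)
  (fun n => powR_ge0 (psi n) delta) poo.
pose s := [seq n <- index_iota A B | (m n <= n)%N].
have sP n : n \in s -> [/\ (0 < n)%N, (m n <= n)%N & (A <= n)%N].
  rewrite mem_filter mem_index_iota => /and3P[mn An _].
  by split => //; exact: leq_trans An.
have : (mu G * (\sum_(n <- s) 2 ^- m n)%:E <= 1)%E.
  apply: (mu_avoid_le psi) => //.
  - by rewrite filter_uniq// iota_uniq.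
  - by move=> n /sP[n0 mn _]; split => //; have [] := mP n n0.
  - by move=> x [].
  - by move=> n x /sP[_ _ An] [_ nx] xn; apply: nx; exists n.
rewrite -(fineK mufin) -/g -EFinM lee_fin => gs; apply/negP; rewrite -ltNge.
have : \sum_(A <= n < B) Num.min 1 (psi n `^ delta) <=
    \sum_(A <= n < B) (2 * (if (m n <= n)%N then 2 ^- m n else 0) + 2 * 2 ^- n).
  apply: ler_sum_nat => n /andP[An _].
  have n0 : (0 < n)%N by exact: leq_trans An.
  have [_ /le_trans] := mP n n0; apply.
  case: leqP => mn; first by rewrite lerDl mulr_ge0.
  rewrite mulr0 add0r ler_pM2l// lef_pV2 ?posrE ?exprn_gt0//.
  by rewrite ler_eXn2l ?ltr1n// ltnW.
move=> /le_lt_trans; apply.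
rewrite big_split/= -!mulr_sumr -big_mkcond/= -big_filter -/s.
rewrite ltr_leD//; last by rewrite ler_pM2l// sum_expV2_le.
rewrite ltr_pM2l//; apply: (@le_lt_trans _ _ g^-1); last by rewrite ltrDl.
by rewrite -[leRHS]mulr1 ler_pdivlMl.
Qed.

(** A point of the Cantor set outside the recurrence set avoids all returns
    from some time on, and there are countably many such times. *)
Lemma mu_recurrence_set1 (psi : nat -> R) :
  (forall n, (0 < n)%N -> 0 < psi n) ->
  (\sum_(1 <= n <oo) (psi n `^ delta)%:E = +oo)%E ->
  mu (recurrence_set psi) = 1%E.
Proof.
move=> psi0 poo.
have mR : measurable (recurrence_set psi : set (measurableTypeR R)).
  rewrite recurrence_setE; apply: bigcap_measurable => // A _.
  by apply: bigcup_measurable => n _; exact: measurable_returns.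
pose G A := cantor_set R `\` \bigcup_(n >= A.+1) returns n (psi n).
have mG A : measurable (G A : set (measurableTypeR R)).
  apply: measurableD; first exact: measurable_cantor_set.
  by apply: bigcup_measurable => n _; exact: measurable_returns.
have G0 : mu (\bigcup_A G A) = 0%E.
  apply/eqP; rewrite eq_le measure_ge0 andbT.
  apply: le_trans (measure_sigma_subadditive _ _ _ (@subset_refl _ _)) _ => //.
    exact: bigcup_measurable.
  by rewrite eseries0// => A _ _; exact: mu_avoid_tail0.
apply/eqP; rewrite eq_le probability_le1//=.
rewrite -(mu_cantor_set mu hmu) -[leRHS]adde0 -G0.
apply: le_trans (measureU2 _ mR (bigcup_measurable (fun A _ => mG A))).
apply: le_measure; rewrite ?inE.
- exact: measurable_cantor_set.
- by apply: measurableU => //; exact: bigcup_measurable.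
move=> x Kx; have [xR|xR] := pselect (recurrence_set psi x); first by left.
right; apply: contrapT => nG; apply: xR; rewrite recurrence_setE => A _.
apply: contrapT => nA; apply: nG; exists A => //; split=> // -[[//|n] /= An xn].
by apply: nA; exists n.
Qed.

End Dichotomy.

Theorem theorem3p4 (R : realType) (mu : probability (measurableTypeR R) R)
    (hmu : is_cantor_measure mu)
    (psi : nat -> R) (psi_gt0 : forall n : nat, (0 < n)%N -> 0 < psi n) :
  let delta : R := ln 2 / ln 3 in
  ((\sum_(1 <= n <oo) (psi n `^ delta)%:E < +oo)%E ->
     mu (recurrence_set psi) = 0%E) /\
  ((\sum_(1 <= n <oo) (psi n `^ delta)%:E = +oo)%E ->
     mu (recurrence_set psi) = 1%E).
Proof.
by split; [exact: mu_recurrence_set0|exact: mu_recurrence_set1].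
Qed.
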